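(* For every $\epsilon > 0$ there exists $\delta > 0$ such that the following holds for all sufficiently large positive integers $k$: setting $r_k = \lfloor (1+\delta)k \rfloor$, for every positive integer $n < (1/2-\epsilon)k^2$, no word $\sigma \in [r_k]^n$ is a $k$-superpattern.
   Context: For a positive integer $m$, $[m] = \{1,\dots,m\}$, and $S_k$ is the set of permutations of $[k]$. A word $\sigma \in [r]^n$ is a sequence $\sigma(1),\dots,\sigma(n)$ of elements of $[r]$. A word $\sigma\in[r]^n$ contains $\tau \in S_k$ as a pattern if there are indices $1\le i_1<\dots<i_k\le n$ such that for all $j,j'\in[k]$, $\sigma(i_j)<\sigma(i_{j'})$ if and only if $\tau(j)<\tau(j')$. The word $\sigma$ is a $k$-superpattern if it contains every $\tau\in S_k$ as a pattern. *)

(* Defs.v *)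
From mathcomp Require Import all_boot all_order all_algebra all_fingroup.
From mathcomp Require Import reals.

Set Implicit Arguments.
Unset Strict Implicit.
Unset Printing Implicit Defensive.

(* The set [m] = {1, ..., m} is represented by the order-isomorphic
   'I_m = {0, ..., m - 1}, both for positions and for letters; only the order
   of positions and letters matters below. *)

Definition word (r n : nat) := n.-tuple 'I_r.

Definition contains_pattern (r n k : nat) (s : word r n) (t : 'S_k) : Prop :=
  exists i : 'I_k -> 'I_n,
    (forall j j' : 'I_k, (j < j')%N -> (i j < i j')%N) /\
    (forall j j' : 'I_k,
        (tnth s (i j) < tnth s (i j'))%N <-> (t j < t j')%N).

Definition superpattern (r n k : nat) (s : word r n) : Prop :=
  forall t : 'S_k, contains_pattern s t.
Arguments superpattern {r n} k s.

(* Main.v *)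
Require Import Defs.
From mathcomp Require Import all_boot all_order all_algebra all_fingroup.
From mathcomp Require Import reals.
From mathcomp Require Import sequences exp.
From mathcomp Require Import zify ring lra.
Import Order.TTheory GRing.Theory Num.Theory.
Local Open Scope ring_scope.

(* Cut a pattern into b blocks of s = k / b consecutive entries, b a large
   constant. If the pattern occurs in a word of length n, then one of its blocks
   occurs in a window of length L = n / b. Distinct letters have distinct first
   occurrences, so the words u of length s that are subsequences of a given
   window number at most z^(-L) (z + ... + z^r)^s for 0 < z <= 1. With
   z = exp(-l/k) and n < (1/2 - eps) k^2 this is at most
   k^s exp(-c eps^2 k / b), whereas a block can be chosen in about
   k^s exp(-O(k / b^2)) ways; so for b much larger than eps^-2 a fixed block of a
   random pattern has exponentially small probability to occur in a given
   window. This beats the number of windows, which is polynomial in k, and the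
   number 'C(r, k) of sets of letters that an occurrence may use, whose
   exponential growth rate in k tends to 0 with delta. *)

(** * Counting the subsequences of a given word *)

(** Appending a letter on the right keeps the earlier first occurrences; a new letter first occurs
    at index [size w], at least [#|w|], so it adds at most [z ^+ #|w|]. *)
Lemma sum_index_le (R : numDomainType) (T : finType) (z : R) (w : seq T) :
  0 <= z <= 1 -> \sum_(x in w) z ^+ index x w <= \sum_(i < #|w|) z ^+ i.
Proof.
move=> /andP[z0 z1]; elim/last_ind: w => [|w y IHw].
  by rewrite big_pred0 // sumr_ge0 // => i _; apply: exprn_ge0.
have [yw|yw] := boolP (y \in w).
  have eqw : rcons w y =i w.
    by move=> x; rewrite mem_rcons inE; case: eqP => // ->.
  rewrite (eq_card eqw) (eq_bigl _ _ eqw); apply: le_trans IHw.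
  by apply: ler_sum => x xw; rewrite -cats1 index_cat xw.
have eqw x : (x \in rcons w y) = (x == y) || (x \in w) by rewrite mem_rcons inE.
have -> : #|rcons w y| = #|w|.+1.
  by rewrite (eq_card eqw) (cardU1 y (mem w)) yw.
rewrite big_ord_recr /= (bigD1 y) ?eqw ?eqxx //= addrC; apply: lerD.
  apply: le_trans IHw; rewrite (eq_bigl (mem w)) => [|x].
    by apply: ler_sum => x xw; rewrite -cats1 index_cat (xw : x \in w).
  rewrite eqw; have [->|_] := eqVneq x y; last by rewrite andbT.
  by rewrite andbF; apply/esym/negbTE.
rewrite -cats1 index_cat (negPf yw) /= eqxx addn0.
by apply: ler_wiXn2l => //; apply: card_size.
Qed.

Lemma subseq_cons_index (T : eqType) (x : T) (u w : seq T) :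
  subseq (x :: u) w = (x \in w) && subseq u (drop (index x w).+1 w).
Proof.
elim: w => [|y w IHw] //=; rewrite inE [y == x]eq_sym; case: eqP => [_|_] /=.
  by rewrite drop0.
exact: IHw.
Qed.

(* Induction on s along the greedy (leftmost) occurrence of u in w. *)
Lemma card_subseq_le (R : numFieldType) (T : finType) (z : R) (s : nat) (w : seq T) :
  0 < z <= 1 ->
  #|[set u : s.-tuple T | subseq u w]|%:R * z ^+ size w
    <= (\sum_(i < #|T|) z ^+ i.+1) ^+ s.
Proof.
move=> /andP[z0 z1]; elim: s w => [|s IHs] w.
  rewrite expr0 mulr_ile1 ?ler0n ?exprn_ge0 ?exprn_ile1 ?(ltW z0) //.
  by rewrite lern1 (leq_trans (max_card _)) // card_tuple.
set G := \sum_(i < _) _ in IHs *.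
have -> : #|[set u : s.+1.-tuple T | subseq u w]| =
    (\sum_(x in w) #|[set u : s.-tuple T | subseq u (drop (index x w).+1 w)]|)%N.
  rewrite -sum1dep_card (reindex (fun p : T * s.-tuple T => cons_tuple p.1 p.2)) /=.
    rewrite (eq_bigl (fun p : T * s.-tuple T =>
        (p.1 \in w) && subseq p.2 (drop (index p.1 w).+1 w))).
      rewrite -(pair_big_dep _
        (fun x u => subseq (val u) (drop (index x w).+1 w)) (fun _ _ => 1%N)) /=.
      by apply: eq_bigr => x _; rewrite sum1dep_card.
    by move=> [x u]; rewrite -subseq_cons_index.
  exists (fun u : s.+1.-tuple T => (thead u, [tuple of behead u])) => [[x u]|u] _.
    rewrite /= theadE; congr (_, _); exact: val_inj.
  by rewrite [in RHS](tuple_eta u); apply: val_inj.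
rewrite natr_sum mulr_suml exprS.
have G0 : 0 <= G by apply: sumr_ge0 => i _; rewrite exprn_ge0 ?(ltW z0).
(* The induction hypothesis on the suffix after the first [x] uses up [z] to the length of that
   suffix and leaves the exponent [(index x w).+1]. *)
apply: le_trans (_ : \sum_(x in w) z ^+ (index x w).+1 * G ^+ s <= _).
  apply: ler_sum => x xw.
  have xs : ((index x w).+1 <= size w)%N by rewrite index_mem.
  rewrite -[in z ^+ size w](subnKC xs) exprD mulrCA ler_wpM2l ?exprn_ge0 ?(ltW z0) //.
  by rewrite -size_drop IHs.
rewrite -mulr_suml ler_wpM2r ?exprn_ge0 // /G.
under eq_bigr do rewrite exprS; under [leRHS]eq_bigr do rewrite exprS.
rewrite -!mulr_sumr ler_wpM2l ?(ltW z0) //.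
apply: le_trans (@sum_index_le _ _ z w _) _; first by rewrite (ltW z0).
rewrite -(subnKC (max_card (mem w))) big_split_ord /= lerDl.
by apply: sumr_ge0 => i _; rewrite exprn_ge0 ?(ltW z0).
Qed.

(** * Locating a block of a pattern in a short window *)

Lemma subseq_catl_split (T : eqType) (u v w : seq T) :
  subseq (u ++ v) w -> exists w1 w2, [/\ w = w1 ++ w2, subseq u w1 & subseq v w2].
Proof.
elim: w u => [|y w IHw] [|x u] //=.
- by move=> vw; exists [::], [::].
- by move=> vw; exists [::], (y :: w).
have [->|xy] := eqVneq x y.
  by case/IHw=> w1 [w2 [-> uw1 vw2]]; exists (y :: w1), w2; rewrite /= eqxx.
case/(IHw (x :: u))=> w1 [w2 [-> uw1 vw2]]; exists (y :: w1), w2.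
by rewrite /= (negPf xy).
Qed.

(** Split [w] so that the first block lies in [w1] and the rest of [v] in [w2]. Either [w1] fits
    into the first window, or it uses up at least [L.+1] letters and induction applies to [w2] with
    one block fewer. *)
Lemma subseq_block_window (T : eqType) (s L b : nat) (v w : seq T) :
  (size w < b * L.+1)%N -> subseq v w ->
  exists j p, [/\ (j < b)%N, (p <= size w)%N &
    subseq (take s (drop (j * s) v)) (take L (drop p w))].
Proof.
elim: b v w => [|b IHb] v w // ltw.
rewrite -{1}[v](cat_take_drop s) => /subseq_catl_split[w1 [w2 [defw vw1 vw2]]].
have [w1L|Lw1] := leqP (size w1) L.
  exists 0%N, 0%N; split=> //; rewrite mul0n !drop0 defw take_cat ltnNge w1L /=.
  exact: subseq_trans vw1 (prefix_subseq _ _).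
have [||j [p [jb pw2 sub]]] := IHb (drop s v) w2 => //.
  by move: ltw; rewrite defw size_cat mulSn; lia.
exists j.+1, (size w1 + p)%N; split=> //.
  by rewrite defw size_cat leq_add2l.
by move: sub; rewrite drop_drop mulSn addnC defw drop_cat ltnNge leq_addr addKn.
Qed.

(** * Counting permutations with a prescribed block, and the union bound *)

(** For a fixed member [t0], the translates [t * t0^-1] of the members [t] fix [B] pointwise, hence
    permute only its complement. *)
Lemma card_perm_agree (T : finType) (U : eqType) (B : {set T}) (f g : T -> U) :
  injective g ->
  (#|[set t : {perm T} | [forall x in B, g (t x) == f x]]| <= (#|T| - #|B|)`!)%N.
Proof.
move=> injg; set X := [set t | _].
have [->|[t0 Xt0]] := set_0Vmem X; first by rewrite cards0.
rewrite -(cardsC B) addKn -card_perm -(card_imset X (mulIg t0^-1)%g).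
apply/subset_leq_card/subsetP => _ /imsetP[t Xt ->]; rewrite unfold_in.
apply/subsetP => x; rewrite !inE; apply: contraNN => xB.
rewrite permM -(inj_eq (@perm_inj _ t0)) permKV -(inj_eq injg).
move: Xt Xt0; rewrite !inE => /forall_inP/(_ _ xB)/eqP -> /forall_inP/(_ _ xB)/eqP ->.
exact: eqxx.
Qed.

(** Group the permutations by the word [u] that they spell along [e]; each [u] prescribes a
    permutation at [s] points. *)
Lemma card_perm_block (T U : finType) (s : nat) (g : T -> U) (e : s.-tuple T)
    (w : seq U) :
  injective g -> uniq e ->
  (#|[set t : {perm T} | subseq [seq g (t i) | i <- e] w]|
     <= #|[set u : s.-tuple U | subseq u w]| * (#|T| - s)`!)%N.
Proof.
move=> injg une; rewrite -sum1dep_card.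
rewrite (partition_big (fun t : {perm T} => map_tuple (fun i => g (t i)) e)
  (mem [set u : s.-tuple U | subseq u w])) => [|t] /=; last by rewrite inE.
rewrite -sum_nat_const; apply: leq_sum => u _; rewrite sum1dep_card.
have card_e : #|[set x in e]| = s by rewrite cardsE (card_uniqP une) size_tuple.
rewrite -[X in (_ - X)%N]card_e.
(* The prescribed value at [x] is the letter of [u] at the place of [x] in [e]; the default [g x] is
   never reached on [e]. *)
apply: leq_trans (card_perm_agree _ _ _ (fun x => nth (g x) u (index x e)) g injg).
apply/subset_leq_card/subsetP => t; rewrite !inE => /andP[_ /eqP <-].
apply/forall_inP => x; rewrite inE => xe.
by rewrite (nth_map x) ?index_mem // nth_index.
Qed.

Lemma sorted_enum_ord (n : nat) : sorted (relpre val ltn) (enum 'I_n).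
Proof. by rewrite -sorted_map val_enum_ord iota_ltn_sorted. Qed.

(** A strictly sorted list is determined by its members, so the image list is the full enumeration
    filtered by membership. *)
Lemma subseq_map_enum_ord (k n : nat) (i : 'I_k -> 'I_n) :
  {homo i : j j' / (j < j')%N} -> subseq [seq i j | j <- enum 'I_k] (enum 'I_n).
Proof.
move=> imono; set e := map _ _.
have -> : e = filter (mem e) (enum 'I_n); last exact: filter_subseq.
apply: (@irr_sorted_eq _ (relpre val ltn)).
- by move=> y x z /= xy yz; apply: ltn_trans yz.
- by move=> x /=; apply: ltnn.
- exact: homo_sorted (sorted_enum_ord k).
- apply: sorted_filter (sorted_enum_ord n).
  by move=> y x z /= xy yz; apply: ltn_trans yz.
- by move=> x; rewrite mem_filter mem_enum andbT.
Qed.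

(** Union bound: every permutation is caught by some choice of [k] letters, block and window start,
    and each such choice catches at most [M * (k - s)!] permutations. *)
Lemma fact_superpattern (r n k s L b M : nat) (w : word r n) :
  superpattern k w -> (n < b * L.+1)%N -> (b * s <= k)%N ->
  (forall w' : seq 'I_r, (size w' <= L)%N ->
     (#|[set u : s.-tuple 'I_r | subseq u w']| <= M)%N) ->
  (k`! <= 'C(r, k) * (b * (n.+1 * (M * (k - s)`!))))%N.
Proof.
move=> supw nbL bsk boundM.
pose blk j := take s (drop (j * s) (enum 'I_k)).
pose win p := take L (drop p w).
pose X (q : k.-tuple 'I_r * ('I_b * 'I_n.+1)) := 
  [set t : 'S_k | subseq [seq tnth q.1 (t i) | i <- blk q.2.1] (win q.2.2)].
pose inc := [set f : k.-tuple 'I_r | sorted ltn [seq val i | i <- f]].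
have cardX q : q.1 \in inc -> (#|X q| <= M * (k - s)`!)%N.
  rewrite inE => incq.
  have sz : size (blk q.2.1) == s.
    apply/eqP; rewrite size_takel // size_drop size_enum_ord leq_subRL.
      by rewrite -mulSnr (leq_trans _ bsk) // leq_mul2r ltn_ord orbT.
    by rewrite (leq_trans _ bsk) // leq_mul2r ltnW ?ltn_ord ?orbT.
  have inj : injective (tnth q.1).
    apply/tuple_uniqP; rewrite -(map_inj_uniq val_inj).
    exact: sorted_uniq ltn_trans ltnn _ incq.
  have une : uniq (Tuple sz) by rewrite take_uniq ?drop_uniq ?enum_uniq.
  have := card_perm_block _ _ s (tnth q.1) (Tuple sz) (win q.2.2) inj une.
  rewrite card_ord => /leq_trans; apply; rewrite leq_mul2r boundM ?orbT //.
  by rewrite size_take_min geq_minl.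
(* q.1 lists, in increasing order, the letters used by the occurrence of t. *)
have cover t : exists q, (q.1 \in inc) && (t \in X q).
  have [i [imono iw]] := supw t.
  pose f := [tuple tnth w (i ((t^-1)%g j)) | j < k].
  have [||j [p [jb pn sub]]] :=
    subseq_block_window _ s L b [seq tnth f (t j) | j <- enum 'I_k] w.
  - by rewrite size_tuple.
  - have -> : [seq tnth f (t j) | j <- enum 'I_k] = [seq tnth w (i j) | j <- enum 'I_k].
      by apply: eq_map => j; rewrite tnth_mktuple permK.
    rewrite -[X in subseq _ X]map_tnth_enum (map_comp (tnth w) i).
    exact: map_subseq (subseq_map_enum_ord _ _ i imono).
  rewrite size_tuple in pn.
  exists (f, (Ordinal jb, Ordinal (pn : (p < n.+1)%N))); rewrite !inE /=.
  apply/andP; split; last by rewrite /blk map_take map_drop.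
  rewrite -map_comp; apply: homo_sorted (sorted_enum_ord k) => h h' /= hh'.
  by rewrite (iw _ _).2 // !permKV.
have -> : k`! = (\sum_(t : 'S_k) 1)%N by rewrite sum1_card card_Sn.
apply: (@leq_trans (\sum_(t : 'S_k) \sum_(q | (q.1 \in inc) && (t \in X q)) 1)%N).
  apply: leq_sum => t _; have [q qt] := cover t.
  by rewrite (bigD1 q).
rewrite (exchange_big_dep (fun q => q.1 \in inc)) /=; last by move=> t q _ /andP[].
apply: (@leq_trans (\sum_(q : k.-tuple 'I_r * ('I_b * 'I_n.+1) | q.1 \in inc)
    M * (k - s)`!)%N).
  apply: leq_sum => q incq; apply: leq_trans (cardX q incq).
  by rewrite incq /= sum1_card.
have -> : 'C(r, k) = #|inc| by rewrite card_ltn_sorted_tuples.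
rewrite sum_nat_const !mulnA 2!leq_mul2r.
have <- : #|setX inc [set: 'I_b * 'I_n.+1]| = (#|inc| * b * n.+1)%N.
  by rewrite cardsX cardsT card_prod !card_ord mulnA.
apply/orP; right; apply/orP; right.
by apply/subset_leq_card/subsetP => -[f jp]; rewrite in_setX in_setT andbT.
Qed.

(** * Exponential estimates *)

(** The product of ['C(r, k)] and [x ^+ (r - k)] is one term of the expansion of [(x + 1) ^+ r];
    then [1 + y <= expR y] is used for [y = x] and [y = x^-1]. When [r - k] is at most [x ^+ 2 * k],
    the exponent is of order [x * k]. *)
Lemma bin_le_expR (R : realType) (r k : nat) (x : R) :
  (k <= r)%N -> 0 < x ->
  'C(r, k)%:R <= expR (x * r%:R + (r%:R - k%:R) / x).
Proof.
move=> kr x0; rewrite -natrB // expRD expRM_natr mulrC [_ / _]mulrC expRM_natr.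
have -> : 'C(r, k)%:R = x^-1 ^+ (r - k) * ('C(r, k)%:R * x ^+ (r - k)).
  by rewrite mulrCA -exprMn mulVf ?gt_eqF // expr1n mulr1.
have ltkr : (k < r.+1)%N by [].
apply: ler_pM; rewrite ?mulr_ge0 ?exprn_ge0 ?invr_ge0 ?(ltW x0) //.
  rewrite lerXn2r ?nnegrE ?invr_ge0 ?expR_ge0 ?(ltW x0) //.
  by apply: le_trans (expR_ge1Dx _); rewrite lerDr.
apply: le_trans (_ : (x + 1) ^+ r <= _); last first.
  by rewrite lerXn2r ?nnegrE ?addr_ge0 ?expR_ge0 ?(ltW x0) // addrC expR_ge1Dx.
rewrite exprDn (bigD1 (Ordinal ltkr)) //= expr1n mulr1 mulr_natl lerDl.
by apply: sumr_ge0 => i _; rewrite expr1n mulr1 mulrn_wge0 ?exprn_ge0 ?ltW.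
Qed.

Lemma expRN_le (R : realType) (y : R) : 0 <= y -> expR (- y) <= 1 - y + y ^+ 2.
Proof.
move=> y0; rewrite expRN; apply: (@le_trans _ _ (1 + y)^-1).
  by rewrite lef_pV2 ?posrE ?expR_gt0 ?expR_ge1Dx // ltr_pwDl.
by rewrite -[_^-1]mul1r ler_pdivrMr ?ltr_pwDl //; nra.
Qed.

(** The first [k] terms are bounded by [expRN_le] and summed as an arithmetic progression; each of
    the other [r - k] terms is at most 1. *)
Lemma sum_expR_le (R : realType) (k r : nat) (l : R) :
  (0 < k)%N -> (k <= r)%N -> 0 <= l ->
  \sum_(i < r) expR (- l / k%:R) ^+ i.+1
    <= k%:R * expR (- l / 2 + l ^+ 2 + (r%:R - k%:R) / k%:R).
Proof.
move=> k0 kr l0; have K0 : (0 : R) < k%:R by rewrite ltr0n.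
apply: (@le_trans _ _ (k%:R * (1 - l / 2 + l ^+ 2 + (r%:R - k%:R) / k%:R))); last first.
  rewrite ler_pM2l //; apply: le_trans (expR_ge1Dx _); lra.
have -> : k%:R * (1 - l / 2 + l ^+ 2 + (r%:R - k%:R) / k%:R) =
    k%:R * (1 - l / 2 + l ^+ 2) + (r%:R - k%:R) :> R by field; rewrite gt_eqF.
rewrite -natrB // -[in leLHS](subnKC kr) big_split_ord /=; apply: lerD.
  apply: (@le_trans _ _ (\sum_(i < k) (1 + l ^+ 2 - l / k%:R * i.+1%:R))).
    apply: ler_sum => i _; rewrite -expRM_natr mulrAC !mulNr.
    have y0 : 0 <= l * i.+1%:R / k%:R by rewrite !mulr_ge0 ?invr_ge0 ?ler0n.
    apply: le_trans (expRN_le _ _ y0) _.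
    have : i.+1%:R / k%:R <= 1 :> R by rewrite ler_pdivrMr // mul1r ler_nat ltn_ord.
    have : 0 <= i.+1%:R / k%:R :> R by rewrite divr_ge0.
    have -> : l / k%:R * i.+1%:R = l * (i.+1%:R / k%:R) by ring.
    rewrite -mulrA; move: (_ / _) => q q0 q1.
    have : q ^+ 2 <= 1 by rewrite expr_le1.
    rewrite exprMn; have := sqr_ge0 l; nra.
  rewrite sumrB sumr_const card_ord -mulr_sumr.
  have -> : \sum_(i < k) i.+1%:R = k%:R * (k%:R + 1) / 2 :> R.
    elim: (k) => [|j IHj]; first by rewrite big_ord0 !mul0r.
    by rewrite big_ord_recr /= IHj -natr1; field.
  rewrite -[X in X - _]mulr_natl.
  have -> : l / k%:R * (k%:R * (k%:R + 1) / 2) = l * (k%:R + 1) / 2.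
    by field; rewrite gt_eqF.
  nra.
rewrite -[(r - k)%N in leRHS]card_ord -sumr_const; apply: ler_sum => i _.
rewrite exprn_ile1 ?expR_ge0 // expR_le1 mulNr oppr_le0.
by rewrite divr_ge0 ?ler0n.
Qed.

(** Each factor of [k ^_ s] is at least [k - s], and [a.+1 * s <= k] gives
    [k <= (k - s) * (1 + a^-1)]. *)
Lemma ffact_ge_expR (R : realType) (k s a : nat) :
  (0 < a)%N -> (a.+1 * s <= k)%N -> 
  k%:R ^+ s <= (k ^_ s)%:R * expR (s%:R / a%:R) :> R.
Proof.
move=> a0 ask; have A0 : (0 : R) < a%:R by rewrite ltr0n.
have sk : (s <= k)%N by apply: leq_trans ask; rewrite leq_pmull.
apply: (@le_trans _ _ ((k - s)%:R ^+ s * expR (s%:R / a%:R))); last first.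
  rewrite ler_wpM2r ?expR_ge0 // -natrX ler_nat ffact_prod.
  rewrite -[X in (_ ^ X <= _)%N]card_ord -prod_nat_const.
  by apply: leq_prod => i _; rewrite leq_sub2l // ltnW.
rewrite expRM_natl -exprMn lerXn2r ?nnegrE ?mulr_ge0 ?expR_ge0 ?ler0n //.
apply: (@le_trans _ _ ((k - s)%:R * (1 + a%:R^-1))); last first.
  by rewrite ler_wpM2l // expR_ge1Dx.
have -> : (k - s)%:R * (1 + a%:R^-1) = (k%:R - s%:R) * (a%:R + 1) / a%:R :> R.
  by rewrite natrB //; field; rewrite gt_eqF.
rewrite ler_pdivlMr //; move: ask; rewrite -(ler_nat R) natrM -natr1; nra.
Qed.

(** The exponent collects, in order, the loss from [k ^+ s] to [k ^_ s], the power sum, the factor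
    [z ^- L], and the choice of letters. *)
Lemma superpattern_expR_bound (R : realType) (r n k a s : nat) (l x : R) (w : word r n) :
  superpattern k w -> (0 < k <= r)%N -> (0 < a)%N -> (a.+1 * s <= k)%N ->
  0 <= l -> 0 < x ->
  1 <= a.+1%:R * n.+1%:R *
    expR (s%:R / a%:R + s%:R * (- l / 2 + l ^+ 2 + (r%:R - k%:R) / k%:R) +
          l * n%:R / (k%:R * a.+1%:R) + (x * r%:R + (r%:R - k%:R) / x)).
Proof.
move=> supw /andP[k0 kr] a0 ask l0 x0.
have K0 : (0 : R) < k%:R by rewrite ltr0n.
have sk : (s <= k)%N by apply: leq_trans ask; rewrite leq_pmull.
pose L := (n %/ a.+1)%N; pose z := expR (- l / k%:R).
have nL : (n < a.+1 * L.+1)%N by rewrite mulnC ltn_ceil.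
(* [F] bounds the number of words of length [s] occurring in a window; its truncation serves as the
   natural number [M] of the union bound. *)
pose F := (k%:R * expR (- l / 2 + l ^+ 2 + (r%:R - k%:R) / k%:R)) ^+ s
          * expR (l * n%:R / (k%:R * a.+1%:R)).
have F0 : 0 <= F by rewrite mulr_ge0 ?exprn_ge0 ?mulr_ge0 ?expR_ge0 ?ler0n.
have z0 : 0 < z by apply: expR_gt0.
have z1 : z <= 1 by rewrite expR_le1 mulNr oppr_le0 divr_ge0.
have boundF (w' : seq 'I_r) : (size w' <= L)%N ->
    (#|[set u : s.-tuple 'I_r | subseq u w']| <= Num.truncn F)%N.
  move=> w'L; rewrite truncn_ge_nat //.
  have := card_subseq_le R _ z s w'; rewrite z0 z1 card_ord => /(_ isT).
  rewrite -ler_pdivlMr ?exprn_gt0 // => /le_trans; apply.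
  rewrite -exprVn /F; apply: ler_pM.
  - by rewrite exprn_ge0 // sumr_ge0 // => i _; rewrite exprn_ge0 ?ltW.
  - by rewrite exprn_ge0 ?invr_ge0 ?ltW.
  - rewrite lerXn2r ?nnegrE ?mulr_ge0 ?expR_ge0 ?ler0n ?sum_expR_le //.
    by rewrite sumr_ge0 // => i _; rewrite exprn_ge0 ?ltW.
  rewrite -expRN mulNr opprK -expRM_natr ler_expR.
  rewrite invfM [leRHS]mulrACA ler_wpM2l ?divr_ge0 //.
  rewrite ler_pdivlMr ?ltr0n // -natrM ler_nat.
  by apply: leq_trans (leq_divM n a.+1); rewrite leq_mul2r w'L orbT.
have := fact_superpattern r n k s L a.+1 _ w supw nL ask boundF.
rewrite -(ffact_fact sk) !mulnA leq_pmul2r ?fact_gt0 // -!mulnA.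
rewrite -(ler_nat R) !natrM => cnt.
set E1 := s%:R / a%:R; set E2 := _ + _ / k%:R in F F0 boundF cnt *.
set E3 := l * n%:R / _ in F F0 boundF cnt *; set E4 := x * _ + _.
have Ks : 0 < k%:R ^+ s :> R by apply: exprn_gt0.
rewrite -(ler_pM2l Ks) mulr1; apply: le_trans (ffact_ge_expR R k s a a0 ask) _.
rewrite -/E1.
have -> : k%:R ^+ s * (a.+1%:R * n.+1%:R * expR (E1 + s%:R * E2 + E3 + E4)) =
    expR E4 * (a.+1%:R * (n.+1%:R * F)) * expR E1.
  by rewrite !expRD (expRM_natl s E2) /F exprMn; ring.
rewrite ler_wpM2r ?expR_ge0 //; apply: le_trans cnt _.
apply: ler_pM; rewrite ?mulr_ge0 ?ler0n ?bin_le_expR //.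
by rewrite !ler_wpM2l ?ler0n // truncn_le.
Qed.

(** * Choice of the constants and conclusion *)

Theorem theorem1 (R : realType) :
  forall eps : R, 0 < eps ->
  exists2 delta : R, 0 < delta &
  exists k0 : nat, forall k : nat, (0 < k)%N -> (k0 <= k)%N ->
  forall n : nat, (0 < n)%N -> n%:R < (2^-1 - eps) * k%:R ^+ 2 ->
  forall s : word (Num.truncn ((1 + delta) * k%:R)) n, ~ superpattern k s.
Proof.
(* Capping [eps] at 1/4 keeps [2^-1 - e] positive. *)
move=> eps eps0; pose e := Num.min eps 4^-1.
have e0 : 0 < e by rewrite lt_min eps0 invr_gt0 ltr0n.
have ele : e <= eps by rewrite ge_min lexx.
have e4 : e <= 4^-1 by rewrite ge_min lexx orbT.
pose a := Num.bound (16 / e ^+ 2).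
have ae : 16 / e ^+ 2 < a%:R by apply: archi_boundP; rewrite divr_ge0 ?sqr_ge0.
have e20 : 0 < e ^+ 2 by apply: exprn_gt0.
have A0 : (0 : R) < a%:R by apply: lt_trans ae; rewrite divr_gt0.
have a0 : (0 < a)%N by rewrite -(ltr0n R).
pose b : R := a.+1%:R; have b0 : 0 < b by rewrite ltr0n.
have b1 : 1 <= b by rewrite ler1n.
(* As [k < b * (s + 1)], this makes [x * k] less than [e ^+ 2 / 96 * (s + 1)]; with [delta = x ^+ 2]
   the choice of letters costs at most three times that. *)
pose x := e ^+ 2 / (96 * b).
have x0 : 0 < x by rewrite divr_gt0 ?mulr_gt0.
have xb : x * b = e ^+ 2 / 96 by rewrite /x; field; rewrite gt_eqF.
pose c := e ^+ 2 / 8; have c0 : 0 < c by rewrite divr_gt0.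
(* Solves the final comparison [b * (b * S) ^+ 2 * expR 2 < (c * S) ^+ 3 / 6] for [S = s + 1], given
   [k < b * S]. *)
pose K : R := b * (b ^+ 3 * expR 2 * 6 / c ^+ 3).
have K0 : 0 <= K by rewrite !mulr_ge0 ?invr_ge0 ?exprn_ge0 ?expR_ge0 ?(ltW b0) ?(ltW c0).
exists (x ^+ 2); first by rewrite exprn_gt0.
exists (Num.bound K) => k k0 Kk n _ nk w supw.
set r := Num.truncn _ in w supw.
have k0R : (0 : R) < k%:R by rewrite ltr0n.
have kK : K < k%:R by apply: lt_le_trans (archi_boundP K0) _; rewrite ler_nat.
have kr : (k <= r)%N.
  by rewrite truncn_ge_nat ?mulr_ge0 ?ler0n ?addr_ge0 ?sqr_ge0 //
    ler_peMl // lerDl sqr_ge0.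
have rk : r%:R <= (1 + x ^+ 2) * k%:R.
  by rewrite truncn_le mulr_ge0 ?addr_ge0 ?sqr_ge0.
pose s := (k %/ a.+1)%N.
have ask : (a.+1 * s <= k)%N by rewrite mulnC leq_divM.
have kS : k%:R < b * (s%:R + 1).
  by rewrite /b natr1 -natrM ltr_nat mulnC ltn_ceil.
(* With [l = e / 2] the terms [- l / 2 + l ^+ 2] and [l * (2^-1 - e)] add up to [l ^+ 2 - l * e],
   whose minimum is [- e ^+ 2 / 4]. *)
have l0 : 0 <= e / 2 by rewrite divr_ge0 ?(ltW e0).
have kr' : (0 < k <= r)%N by rewrite k0.
have := superpattern_expR_bound R r n k a s (e / 2) x w supw kr' a0 ask l0 x0.
set E := (X in expR X); apply/negP; rewrite -ltNge -/b.
have nk' : n%:R < (2^-1 - e) * k%:R ^+ 2.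
  by apply: lt_le_trans nk _; rewrite ler_wpM2r ?sqr_ge0 // lerD2l lerN2.
have s0 : 0 <= s%:R :> R by [].
have x1 : x <= e ^+ 2 / 96.
  by rewrite -xb ler_peMr // ltW.
have e16 : e ^+ 2 <= 16^-1 by nra.
(* The gain [e ^+ 2 / 4] per letter of the block exceeds the error terms by more than [c]; the
   constant 2 absorbs the gap between [s] and [s + 1]. *)
have EE : E <= 2 - c * (s%:R + 1).
  have E1 : s%:R / a%:R <= s%:R * (e ^+ 2 / 16).
    rewrite ler_wpM2l // -[leRHS]invrK lef_pV2 ?posrE ?invr_gt0 ?divr_gt0 //.
    by rewrite invf_div ltW.
  have E2 : (r%:R - k%:R) / k%:R <= x ^+ 2.
    by rewrite ler_pdivrMr //; lra.
  have E2' : s%:R * (- (e / 2) / 2 + (e / 2) ^+ 2 + (r%:R - k%:R) / k%:R)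
      <= s%:R * (- (e / 2) / 2 + (e / 2) ^+ 2 + x ^+ 2).
    by rewrite ler_wpM2l // lerD2l.
  have E3 : e / 2 * n%:R / (k%:R * b) <= e / 2 * (2^-1 - e) * (s%:R + 1).
    rewrite ler_pdivrMr ?mulr_gt0 //.
    have h : (2^-1 - e) * k%:R ^+ 2 <= (2^-1 - e) * (k%:R * (b * (s%:R + 1))).
      by rewrite ler_wpM2l //; [lra | rewrite expr2 ler_pM2l // ltW].
    have -> : e / 2 * (2^-1 - e) * (s%:R + 1) * (k%:R * b) =
        e / 2 * ((2^-1 - e) * (k%:R * (b * (s%:R + 1)))) by ring.
    by rewrite ler_wpM2l // ltW // (lt_le_trans nk').
  have E4 : x * r%:R + (r%:R - k%:R) / x <= 3 * (e ^+ 2 / 96) * (s%:R + 1).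
    have h1 : x * r%:R <= x * (2 * k%:R).
      rewrite ler_pM2l //; apply: le_trans rk _; rewrite ler_wpM2r //; nra.
    have h2 : (r%:R - k%:R) / x <= x * k%:R by rewrite ler_pdivrMr //; lra.
    have h3 : x * k%:R <= x * (b * (s%:R + 1)) by rewrite ler_pM2l // ltW.
    by rewrite mulrA xb in h3; lra.
  have h1 : s%:R * x ^+ 2 <= s%:R * (e ^+ 2 / 96) by rewrite ler_wpM2l //; nra.
  have h2 : 0 <= s%:R * e ^+ 2 by rewrite mulr_ge0 // ltW.
  by apply: le_trans (lerD (lerD (lerD E1 E2') E3) E4) _; rewrite /c; lra.
set S := s%:R + 1 in kS EE.
have S0 : 0 < S by rewrite ltr_wpDl.
(* A cubic lower bound suffices, since the number of windows is only quadratic in [S]. *)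
have expS : (c * S) ^+ 3 / 6 <= expR (c * S).
  have := expR_ge1Dxn 2 (ltW (mulr_gt0 c0 S0)); apply: le_trans.
  by rewrite lerDr.
have nS : n.+1%:R <= (b * S) ^+ 2.
  apply: le_trans (_ : k%:R ^+ 2 <= _); last first.
    by rewrite lerXn2r ?nnegrE ?mulr_ge0 ?(ltW kS) ?(ltW b0) ?(ltW S0).
  rewrite -natrX ler_nat -(ltr_nat R) natrX; apply: lt_le_trans nk' _.
  by rewrite ler_piMl ?sqr_ge0 //; lra.
apply: (@le_lt_trans _ _ (b * (b * S) ^+ 2 * (expR 2 / expR (c * S)))).
  rewrite -expRB; apply: ler_pM; rewrite ?mulr_ge0 ?expR_ge0 ?(ltW b0) //.
    by rewrite ler_pM2l.
  by rewrite ler_expR.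
rewrite mulrA ltr_pdivrMr ?expR_gt0 // mul1r; apply: lt_le_trans expS.
pose Q := b ^+ 3 * expR 2 * 6 / c ^+ 3.
have -> : b * (b * S) ^+ 2 * expR 2 = Q * (c ^+ 3 * S ^+ 2 / 6).
  by rewrite /Q; field; rewrite gt_eqF.
have -> : (c * S) ^+ 3 / 6 = S * (c ^+ 3 * S ^+ 2 / 6) by ring.
have P0 : 0 < c ^+ 3 * S ^+ 2 / 6.
  by apply: divr_gt0 => //; apply: mulr_gt0; apply: exprn_gt0.
rewrite ltr_pM2r //.
by rewrite -(ltr_pM2l b0); apply: lt_trans kS.
Qed.
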